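(* Let $\mu : M \to P$ be a crossed module and let $\iota : P \to Q$ be a morphism of groups. Suppose that $M$ is finite and that the index of $\iota(P)$ in $Q$ is finite. Then the induced crossed module $\iota_{\ast}M$ is finite (i.e. the group $\iota_{\ast}M$ is finite).
   Context: A crossed module is a morphism of groups $\mu : M \to P$ together with a right action $(m,p)\mapsto m^p$ of $P$ on $M$ by automorphisms such that $\mu(m^p)=p^{-1}(\mu m)p$ and $n^{-1}mn = m^{\mu n}$ for all $m,n\in M$, $p\in P$. A morphism from a crossed module $\mu:M\to P$ to a crossed module $\nu:N\to Q$ is a pair of group morphisms $g:M\to N$, $f:P\to Q$ with $\nu g=f\mu$ and $g(m^p)=(gm)^{fp}$. A crossed $P$-module is a crossed module with codomain $P$; a morphism of crossed $P$-modules is a morphism of crossed modules which is the identity on $P$. Given a crossed module $\mu:M\to P$ and a group morphism $\iota:P\to Q$, the induced crossed module is a crossed $Q$-module $\iota_{\ast}M\to Q$ together with a morphism of crossed modules $(\bar\iota,\iota)$ from $M\to P$ to $\iota_{\ast}M\to Q$, characterised up to isomorphism by the universal property: for every crossed $Q$-module $\gamma:C\to Q$ and every morphism of crossed modules $(f,\iota)$ from $\mu:M\to P$ to $\gamma:C\to Q$, there is a unique morphism of crossed $Q$-modules $g:\iota_{\ast}M\to C$ with $g\bar\iota=f$. *)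

(* Defs.v *)
From mathcomp Require Import all_boot all_classical.

Set Implicit Arguments.
Unset Strict Implicit.
Unset Printing Implicit Defensive.

Local Open Scope group_scope.
Local Open Scope classical_set_scope.

Notation gmorphism := UMagmaMorphism.type.

(* The crossed P-module [bdry : M -> P], with [xact m p] for m^p. Groups are
   [groupType]s, not [finGroupType]s: they may be infinite. *)
Structure crossedModule (P : groupType) := CrossedModule {
  xsort :> groupType;
  bdry : gmorphism xsort P;
  xact : xsort -> P -> xsort;
  (* A right action by endomorphisms; the inverse of m |-> m^p is
     m |-> m^(p^-1), so P acts by automorphisms. *)
  xact1 : forall m, xact m 1 = m;
  xactM : forall m p q, xact m (p * q) = xact (xact m p) q;
  xact_mul : forall m n p, xact (m * n) p = xact m p * xact n p;
  bdry_xact : forall m p, bdry (xact m p) = p^-1 * bdry m * p;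
  peiffer : forall m n, n^-1 * m * n = xact m (bdry n)
}.

Definition is_xmorphism (P Q : groupType)
    (M : crossedModule P) (N : crossedModule Q)
    (g : gmorphism M N) (f : gmorphism P Q) : Prop :=
  (forall m, bdry N (g m) = f (bdry M m)) /\
  (forall m p, g (xact m p) = xact (g m) (f p)).

Definition is_Pmorphism (P : groupType) (M N : crossedModule P)
    (g : gmorphism M N) : Prop :=
  is_xmorphism g (idfun : gmorphism P P).

(* Morphisms are compared pointwise ([=1]) because they bundle proofs. *)
Definition is_induced (P Q : groupType) (M : crossedModule P)
    (iota : gmorphism P Q) (I : crossedModule Q) (ibar : gmorphism M I) : Prop :=
  is_xmorphism ibar iota /\
  forall (C : crossedModule Q) (f : gmorphism M C), is_xmorphism f iota ->
    exists g : gmorphism I C,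
      (is_Pmorphism g /\ g \o ibar =1 f) /\
      (forall g' : gmorphism I C,
         is_Pmorphism g' -> g' \o ibar =1 f -> g' =1 g).

Definition right_cosets (Q : groupType) (H : set Q) : set (set Q) :=
  range (fun q : Q => [set h * q | h in H]).

Definition finite_index (Q : groupType) (H : set Q) : Prop :=
  finite_set (right_cosets H).

(* Main.v *)
Require Import Defs.
From HB Require Import structures.
From mathcomp Require Import all_boot all_classical.

(** The universal property forces [I] to be generated, as a group, by the set
    [X] of the elements [(ibar m)^q]: the subgroup generated by [X] is stable
    under [Q], hence is a crossed [Q]-module through which [ibar] factors, and
    uniqueness in the universal property identifies the resulting endomorphism
    of [I] with the identity ([induced_sub_total]).

    This generating set [X]
    - is finite: [(ibar m)^(iota p * q) = (ibar (m^p))^q], so it is enough to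
      let [q] range over representatives of the right cosets of [iota P]
      ([finite_xact_image]);
    - is closed under conjugation in [I], by the Peiffer rule
      [n^-1 m n = m^(bdry n)] ([xact_imageJ]);
    - consists of elements of finite order, being images of elements of the
      finite group [M] under homomorphisms ([xact_image_torsion]).

    By Dietzmann's lemma ([dietzmann]) such a set generates a finite subgroup.
    Indeed, in a word over [X] all occurrences of a letter [x] can be moved to
    the front at the cost of conjugating the other letters, which stay in [X];
    once [x] occurs at least as often as its order, the word can be shortened.
    So every product is the product of a word of bounded length. *)

Local Open Scope classical_set_scope.

Set Implicit Arguments.
Unset Strict Implicit.
Unset Printing Implicit Defensive.

(** * Dietzmann's lemma *)

(** The finite words over the alphabet [X]. *)
Definition words (G : groupType) (X : set G) : set (seq G) :=
  [set s | all [in X] s].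

(** The submonoid generated by [X]; it is the subgroup generated by [X] when
    the elements of [X] have finite order (see [monoid_spanV]). *)
Definition monoid_span (G : groupType) (X : set G) : set G :=
  [set (\prod_(x <- s) x)%g | s in words X].

Section MonoidSpan.
Context (G : groupType) (X : set G).
Local Open Scope group_scope.

Lemma monoid_span1 : monoid_span X 1.
Proof. by exists [::]; rewrite ?big_nil. Qed.

Lemma mem_monoid_span x : X x -> monoid_span X x.
Proof.
by move=> Xx; exists [:: x]; rewrite ?big_seq1 //= /words /= mem_set.
Qed.

Lemma monoid_spanM x y :
  monoid_span X x -> monoid_span X y -> monoid_span X (x * y).
Proof.
move=> [s Xs <-] [t Xt <-]; exists (s ++ t); last by rewrite big_cat.
by rewrite /words /= all_cat; apply/andP.
Qed.

Lemma monoid_spanX x n : monoid_span X x -> monoid_span X (x ^+ n).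
Proof.
move=> Xx; elim: n => [|n IHn]; first exact: monoid_span1.
by rewrite expgS; exact: monoid_spanM.
Qed.

(** Induction principle: a property that holds at [1] and is preserved by left
    multiplication by elements of [X] holds on the submonoid generated by [X]. *)
Lemma monoid_spanP (S : set G) :
    S 1 -> (forall x y, X x -> S y -> S (x * y)) -> monoid_span X `<=` S.
Proof.
move=> S1 SM _ [s Xs <-]; elim: s Xs => [|x s IHs]; first by rewrite big_nil.
rewrite /words /= big_cons => /andP[/set_mem Xx /IHs Ss]; exact: SM.
Qed.

Context (torsX : forall x, X x -> exists2 n, (0 < n)%N & x ^+ n = 1).

(** Inverses are positive powers in a torsion element. *)
Lemma monoid_spanV x : monoid_span X x -> monoid_span X x^-1.
Proof.
apply: (monoid_spanP (S := fun y => monoid_span X y^-1)) => [|y z Xy Xz].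
  by rewrite invg1; exact: monoid_span1.
rewrite invgM; apply: monoid_spanM Xz _.
have [[//|n] _ yn1] := torsX Xy.
have -> : y^-1 = y ^+ n by apply: mulg1_eq; rewrite -expgS.
exact/monoid_spanX/mem_monoid_span.
Qed.

Context (conjX : forall x y, X x -> X y -> X (x ^ y)).

(** All occurrences of a letter can be moved to the front of a word, by
    conjugating the letters that they pass. *)
Lemma gather_letter (x : G) (s : seq G) : X x -> words X s ->
  exists t : seq G, [/\ words X t, size s = (count_mem x s + size t)%N
    & \prod_(y <- s) y = x ^+ count_mem x s * \prod_(y <- t) y].
Proof.
move=> Xx; elim: s => [|y s IHs] /=.
  by exists [::]; split=> //; rewrite mul1g.
rewrite /words /= => /andP[Xy /IHs[t [Xt sz_s prod_s]]].
rewrite big_cons prod_s; have [->|_] := eqVneq y x.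
  exists t; rewrite /= add1n.
  by split=> //; [rewrite sz_s addSn | rewrite expgS mulgA].
exists (y ^ (x ^+ count_mem x s) :: t); split.
- rewrite /words /= Xt andbT; apply/mem_set.
  elim: (count_mem x s) => [|k Xk]; first by rewrite conjg1; exact: set_mem.
  by rewrite expgSr conjgM; exact: conjX.
- by rewrite sz_s /= add0n addnS.
- by rewrite big_cons add0n mulgA (conjgC y) -mulgA.
Qed.

Context (finX : finite_set X).

Lemma size_sum_count (l s : seq G) : {subset s <= l} ->
  (size s <= \sum_(x <- l) count_mem x s)%N.
Proof.
elim: s => [|y s IHs] sl //=.
rewrite big_split /= -add1n leq_add //; last first.
  by apply: IHs => z zs; apply: sl; rewrite inE zs orbT.
have yl : y \in l by apply: sl; exact: mem_head.
by rewrite (big_rem y yl) /= eqxx leq_addr.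
Qed.

(** Choose for each [x] in [X] an exponent [n x > 0] with [x ^+ n x = 1]. The
    bound is the sum of these exponents over a list enumerating [X]: in a
    longer word some letter [x] occurs more than [n x] times. *)
Lemma bounded_words : exists B, forall s, words X s ->
  exists t, [/\ words X t, (size t <= B)%N
    & \prod_(y <- s) y = \prod_(y <- t) y].
Proof.
have [l Xl] := (finite_seqP X).1 finX.
have [n nP] : {n : G -> nat & forall x, X x -> (0 < n x)%N /\ x ^+ n x = 1}.
  apply: (@choice _ _ (fun x k => X x -> (0 < k)%N /\ x ^+ k = 1)) => x.
  have [/torsX[k k0 xk]|nXx] := pselect (X x); first by exists k.
  by exists 0%N.
exists (\sum_(x <- l) n x)%N => s.
have [m] := ubnP (size s); elim: m s => // m IHm s sz_m Xs.
have [sz_le|sz_gt] := leqP (size s) (\sum_(x <- l) n x); first by exists s.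
have [x xl n_lt] : exists2 x, x \in l & (n x < count_mem x s)%N.
  apply/hasP; apply: contraLR sz_gt => /hasPn nlt; rewrite -leqNgt.
  have sub_sl : {subset s <= l}.
    by move=> z /(allP Xs)/set_mem; rewrite Xl.
  apply: leq_trans (size_sum_count sub_sl) _.
  by rewrite !big_seq leq_sum // => z /nlt; rewrite -leqNgt.
have Xx : X x by rewrite Xl.
have [n_gt0 xn1] := nP x Xx.
(* Gather [x] in front and drop [n x] of its occurrences. *)
have [t [Xt sz_s ->]] := gather_letter Xx Xs.
set c := count_mem x s in n_lt sz_s *.
have [||u [Xu sz_u prod_u]] := IHm (nseq (c - n x) x ++ t).
- rewrite size_cat size_nseq -ltnS; apply: leq_trans sz_m.
  by rewrite ltnS sz_s ltn_add2r ltn_subrL n_gt0 (leq_ltn_trans _ n_lt).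
- by rewrite /words /= all_cat all_nseq (mem_set Xx) orbT.
exists u; split=> //; rewrite -prod_u big_cat big_nseq /=; congr (_ * _).
by rewrite iter_mulg_1 -{1}(subnKC (ltnW n_lt)) expgnDr xn1 mul1g.
Qed.

Lemma finite_words_prod B :
  finite_set
    [set \prod_(x <- s) x | s in words X `&` [set s | (size s <= B)%N]].
Proof.
elim: B => [|B IHB].
  apply: sub_finite_set (finite_set1 1) => _ [[|x s] [_ szs] <-] //.
  by rewrite big_nil.
have finU : finite_set ([set 1] `|` X) by rewrite finite_setU.
apply: sub_finite_set (finite_image2 *%g finU IHB).
move=> _ [[|x s] [Xs sz_s] <-].
  exists 1; first by left.
  exists 1; last by rewrite big_nil mulg1.
  by exists [::]; rewrite ?big_nil.
have [/set_mem Xx Xs'] := andP Xs.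
exists x; [by right | exists (\prod_(y <- s) y); last by rewrite big_cons].
by exists s.
Qed.

(** A finite set of elements of finite order that is closed under conjugation
    by its own elements generates a finite subgroup. *)
Theorem dietzmann : finite_set (monoid_span X).
Proof.
have [B BP] := bounded_words.
apply: sub_finite_set (finite_words_prod B) => _ [s /BP[t [Xt szt ->]] <-].
by exists t.
Qed.
End MonoidSpan.

(** * Elements of finite groups, fibre representatives *)

Lemma finite_torsion (G : groupType) : finite_set [set: G] ->
  forall x : G, exists2 n, (0 < n)%N & (x ^+ n = 1)%g.
Proof.
move=> finG x; have [l Gl] := (finite_seqP _).1 finG.
pose s := [seq (x ^+ i)%g | i <- iota 0 (size l).+1].
(* The first [size l + 1] powers of [x] cannot be pairwise distinct. *)
have : ~~ uniq s.
  have sub_sl : {subset s <= l}.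
    by move=> z _; have : [set: G] z by []; rewrite Gl.
  by apply/negP => /uniq_leq_size/(_ sub_sl); rewrite size_map size_iota ltnn.
move=> /(uniqPn 1%g)[i [j [ij]]]; rewrite size_map size_iota => jl.
have il := ltn_trans ij jl.
rewrite !(nth_map 0%N) ?size_iota // !nth_iota // !add0n => xij.
exists (j - i)%N; first by rewrite subn_gt0.
by rewrite expgnFr ?(ltnW ij) // -xij mulgV.
Qed.

(** A map with finite range admits a finite set of representatives of its
    nonempty fibres. *)
Lemma finite_transversal (T : choiceType) (U : Type) (F : T -> U) (x0 : T) :
  finite_set (range F) ->
  exists2 R : set T, finite_set R & forall x, exists2 y, R y & F x = F y.
Proof.
move=> finF; exists [set xget x0 (F @^-1` [set u]) | u in range F].
  exact: finite_image.
move=> x; exists (xget x0 (F @^-1` [set F x])).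
  by exists (F x) => //; exists x.
by have /esym := @xgetPex _ x0 (F @^-1` [set F x]) (ex_intro _ x erefl).
Qed.

(** * Sub-crossed modules and corestriction *)

(** A [Q]-stable subgroup of a crossed [Q]-module, given by its carrier. *)
Structure subXmodule (Q : groupType) (I : crossedModule Q) := SubXmodule {
  xcarrier :> {pred I};
  xcarrier_group : group_closed xcarrier;
  xcarrier_act : forall m q, m \in xcarrier -> xact m q \in xcarrier
}.

Section SubCrossed.
Context (Q : groupType) (I : crossedModule Q) (J : subXmodule I).
Local Open Scope group_scope.

(** The carrier as a group of its own, with the operations of [I]. *)
Definition subx := {x : I | x \in J}.
HB.instance Definition _ := SubChoice.on subx.
HB.instance Definition _ :=
  SubChoice_isSubGroup.Build I _ subx (xcarrier_group J).

Definition subx_bdry : gmorphism subx Q := bdry I \o (val : subx -> I).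

Definition subx_act (m : subx) (q : Q) : subx :=
  exist _ (xact (val m) q) (xcarrier_act q (valP m)).

(** The crossed [Q]-module obtained by restricting boundary and action. *)
Definition sub_crossedModule : crossedModule Q.
Proof.
apply: (@CrossedModule Q subx subx_bdry subx_act).
- by move=> m; apply: val_inj; exact: xact1.
- by move=> m p q; apply: val_inj; exact: xactM.
- by move=> m n p; apply: val_inj; exact: xact_mul.
- by move=> m p; exact: bdry_xact.
- by move=> m n; apply: val_inj; exact: peiffer.
Defined.

End SubCrossed.

Section Corestriction.
Context (Q G : groupType) (I : crossedModule Q) (J : subXmodule I).
Context (f : gmorphism G I) (fJ : forall m, f m \in J).
Local Open Scope group_scope.

(** A homomorphism into [I] with values in [J], seen as a map into [J]. *)
Definition corestr (m : G) : sub_crossedModule J := exist _ (f m) (fJ m).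

Lemma corestrF : {morph corestr : x y / x / y}.
Proof. by move=> x y; apply: val_inj; exact: gmulfF. Qed.

HB.instance Definition _ :=
  isGroupMorphism.Build G (sub_crossedModule J) corestr corestrF.

Definition corestr_morphism : gmorphism G (sub_crossedModule J) := corestr.
End Corestriction.

(** The induced crossed module has no proper sub-crossed module containing the
    image of the canonical morphism. *)
Lemma induced_sub_total (P Q : groupType) (M : crossedModule P)
    (iota : gmorphism P Q) (I : crossedModule Q) (ibar : gmorphism M I)
    (J : subXmodule I) :
  is_induced iota ibar -> (forall m, ibar m \in J) -> forall x, x \in J.
Proof.
move=> [[ibar_b ibar_a] univ] ibarJ x.
have [|g [[[g_b g_a] g_ibar] _]] := univ _ (corestr_morphism ibarJ).
  by split=> [m|m p]; [exact: ibar_b | apply: val_inj; exact: ibar_a].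
(* The composite of [I -> J] with the inclusion, and the identity, both solve
   the universal problem posed by [ibar] itself. *)
pose e : gmorphism I I := (val : subx J -> I) \o g.
have [|g0 [_ g0_uniq]] := univ I ibar; first by [].
have e_g0 : e =1 g0.
  apply: g0_uniq; last first.
    by move=> m;
       have := congr1 (fun y : sub_crossedModule J => sval y) (g_ibar m).
  by split=> [m|m q]; [exact: g_b | rewrite /= g_a].
have id_g0 : (idfun : gmorphism I I) =1 g0 by exact: g0_uniq.
by rewrite -[x]/(idfun x) id_g0 -e_g0; exact: valP.
Qed.

(** * The translates of the image of a crossed module *)

Section ActionTheory.
Context (Q : groupType) (I : crossedModule Q).
Local Open Scope group_scope.

Lemma xact_one (q : Q) : xact (1 : I) q = 1.
Proof. by apply: (mulIg (xact (1 : I) q)); rewrite -xact_mul !mul1g. Qed.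

Lemma xactX (x : I) (q : Q) n : xact (x ^+ n) q = xact x q ^+ n.
Proof. by elim: n => [|n IHn]; rewrite ?xact_one // !expgS xact_mul IHn. Qed.

End ActionTheory.

(** The set of all [(f m)^q], for [m] in [M] and [q] in [Q]. *)
Definition xact_image (P Q : groupType) (M : crossedModule P)
    (I : crossedModule Q) (f : gmorphism M I) : set I :=
  [set xact (f m) q | m in [set: M] & q in [set: Q]].

Section XactImage.
Context (P Q : groupType) (M : crossedModule P) (I : crossedModule Q).
Context (f : gmorphism M I).
Local Open Scope group_scope.
Let X := xact_image f.

Lemma xact_image_act x q : X x -> X (xact x q).
Proof.
by move=> [m _ [r _ <-]]; exists m => //; exists (r * q); rewrite ?xactM.
Qed.

(** By the Peiffer rule, conjugation is given by the action of [Q]. *)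
Lemma xact_imageJ x y : X x -> X (x ^ y).
Proof. by move=> Xx; rewrite conjgE mulgA peiffer; exact: xact_image_act. Qed.

Lemma xact_image_torsion : finite_set [set: M] ->
  forall x, X x -> exists2 n, (0 < n)%N & x ^+ n = 1.
Proof.
move=> finM _ [m _ [q _ <-]]; have [n n0 mn] := finite_torsion finM m.
by exists n => //; rewrite -xactX -gmulfXn mn gmulf1 xact_one.
Qed.

Lemma monoid_span_xact_image_act x q :
  monoid_span X x -> monoid_span X (xact x q).
Proof.
apply: (monoid_spanP (S := fun x => monoid_span X (xact x q))) => [|y z Xy Xz].
  by rewrite xact_one; exact: monoid_span1.
rewrite xact_mul; apply: monoid_spanM Xz.
exact/mem_monoid_span/xact_image_act.
Qed.

(** The subgroup generated by the translates of the image of [f], as a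
    [Q]-stable subgroup; finiteness of [M] makes the generated submonoid a
    subgroup. *)
Definition xact_image_sub (finM : finite_set [set: M]) : subXmodule I.
Proof.
exists [in monoid_span X].
  split=> [|x y]; rewrite !inE; first exact: monoid_span1.
  move=> Xx Xy; apply: monoid_spanM Xx _; apply: monoid_spanV Xy.
  exact: xact_image_torsion finM.
by move=> m q; rewrite !inE; exact: monoid_span_xact_image_act.
Defined.

(** Only finitely many [q] matter: [(f m)^(iota p * r) = (f (m^p))^r], so [q]
    may be replaced by the representative [r] of its coset. *)
Lemma finite_xact_image (iota : gmorphism P Q) :
    is_xmorphism f iota -> finite_set [set: M] -> finite_index (range iota) ->
  finite_set X.
Proof.
move=> [_ f_act] finM; rewrite /finite_index /right_cosets.
move=> /(finite_transversal (1 : Q))[R finR repR].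
apply: sub_finite_set (finite_image2 (fun m q => xact (f m) q) finM finR).
move=> _ [m _ [q _ <-]]; have [r Rr eq_qr] := repR q.
have : [set h * q | h in range iota] q.
  by exists 1; [exists 1; rewrite ?gmulf1 | rewrite mul1g].
rewrite eq_qr => -[_ [p _ <-] <-].
by exists (xact m p) => //; exists r; rewrite // f_act xactM.
Qed.
End XactImage.

Theorem theorem2p1 (P Q : groupType) (M : crossedModule P)
    (iota : gmorphism P Q) (I : crossedModule Q) (ibar : gmorphism M I) :
  is_induced iota ibar ->
  finite_set [set: M] ->
  finite_index (range iota) ->
  finite_set [set: I].
Proof.
move=> ind finM finPQ.
have finX := finite_xact_image ind.1 finM finPQ.
apply: sub_finite_set (dietzmann (xact_image_torsion finM) _ finX).
  move=> x _; suff: x \in xact_image_sub ibar finM by rewrite inE.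
  apply: induced_sub_total ind _ _ => m; rewrite inE.
  by apply: mem_monoid_span; exists m => //; exists 1%g; rewrite ?xact1.
by move=> x y Xx _; exact: xact_imageJ.
Qed.
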